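(* Let $n\ge 1$ and $\alpha\in(0,1)$, and suppose assumptions A.1, A.2 and A.3 (stated in the context) hold. Consider the stepdown procedure with critical values $\alpha_i=\frac{\alpha}{n-i+1+\alpha}$, $i=1,\dots,n$, applied to the $2n$ $p$-values of the hypotheses in $\mathcal{F}_1=\{H_{ij}: i=1,\dots,n,\ j=1,2\}$. Then this procedure strongly controls $\mathrm{FWER}_{\mathcal{F}_1}$ at level $\alpha$; that is, $\mathrm{FWER}_{\mathcal{F}_1}(\theta)\le\alpha$ for every parameter vector $\theta$.
   Context: Setting. $T_1,\dots,T_n$ are real-valued test statistics whose joint law $\mathrm{Pr}_\theta$ depends on an unknown vector $\theta=(\theta_1,\dots,\theta_n)$ of real parameters. $T_i$ has cumulative distribution function $F_{i,\theta_i}$ depending only on $\theta_i$; $F_{i,0}$ is continuous and symmetric about zero, $F_{i,0}(-t)=1-F_{i,0}(t)$ for all $t$; and $F_{i,\theta_i}(t)$ is non-increasing in $\theta_i$ for each fixed $t$. Hypotheses and $p$-values. For $i=1,\dots,n$: $H_{i1}:\theta_i\le 0$ (versus $\theta_i>0$), with $p$-value $1-F_{i,0}(T_i)$, and $H_{i2}:\theta_i>0$ (versus $\theta_i<0$), with $p$-value $F_{i,0}(T_i)$. Under any $\theta$ exactly one of $H_{i1},H_{i2}$ is true. Let $H_i$ denote the true one and $H_{n+i}$ the false one, with $p$-values $P_i$ and $P_{n+i}=1-P_i$; thus $P_i=1-F_{i,0}(T_i)$ if $\theta_i\le 0$ and $P_i=F_{i,0}(T_i)$ if $\theta_i>0$.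 Put $I_0=\{1,\dots,n\}$ (indices of the true nulls). The procedure uses only the $2n$ $p$-values and not the knowledge of which hypotheses are true. Stepdown procedure. Let $P_{(1)}\le\dots\le P_{(2n)}$ be the ordered $p$-values and $H_{(1)},\dots,H_{(2n)}$ the associated hypotheses. The stepdown procedure with critical values $\alpha_1\le\dots\le\alpha_n$ rejects $H_{(1)},\dots,H_{(i^* )}$ and accepts the rest, where $i^*=\max\{1\le i\le n: P_{(j)}\le\alpha_j \text{ for all } j\le i\}$ if the maximum exists; otherwise it accepts all hypotheses. Error rate. $V_1$ is the number of true hypotheses of $\mathcal{F}_1$ that are rejected, and $\mathrm{FWER}_{\mathcal{F}_1}(\theta)=\mathrm{Pr}_\theta\{V_1\ge 1\}$. Assumptions. A.1: for each $i\in I_0$ and each $\theta_i$, $\mathrm{Pr}_{\theta_i}\{P_i\le p\}\le p$ for all $0\le p\le 1$, with equality when $\theta_i=0$ (i.e. $P_i\sim U(0,1)$ when $\theta_i=0$). A.2: for each $i\in I_0$ and each $\theta_i$, $\mathrm{Pr}_{\theta_i}\{P_i\le p\mid P_i\le p'\}\le \mathrm{Pr}_{\theta_i=0}\{P_i\le p\mid P_i\le p'\}$ for all $0\le p\le p'\le 1$ (whenever the conditioning events have positive probability). On the right-hand side $P_i$ is the same function of $T_i$ as on the left and $T_i\sim F_{i,0}$, so the right-hand side equals $p/p'$. A.3: $T_1,\dots,T_n$ are mutually independent. *)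

(* Defs.v *)
From HB Require Import structures.
From mathcomp Require Import all_boot all_order all_algebra.
From mathcomp Require Import all_classical all_reals all_analysis.

Set Implicit Arguments.
Unset Strict Implicit.
Unset Printing Implicit Defensive.
Import Order.TTheory GRing.Theory Num.Theory.
Import numFieldNormedType.Exports.
Local Open Scope classical_set_scope.
Local Open Scope ring_scope.

(* The hypothesis (i, false) is H_i1 : theta_i <= 0, (i, true) is
   H_i2 : theta_i > 0. *)
Definition hyp (n : nat) : finType := ('I_n * bool)%type.

Definition holds (R : realType) n (theta : 'I_n -> R) (h : hyp n) : bool :=
  if h.2 then 0 < theta h.1 else theta h.1 <= 0.

(* p-values at the observed values t of the test statistics; F i x is the
   cumulative distribution function of the i-th statistic at parameter x. *)
Definition pval (R : realType) n (F : 'I_n -> R -> R -> R) (t : 'I_n -> R)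
    (h : hyp n) : R :=
  if h.2 then F h.1 0 (t h.1) else 1 - F h.1 0 (t h.1).

Definition true_hyp (R : realType) n (theta : 'I_n -> R) (i : 'I_n) : hyp n :=
  (i, 0 < theta i).

Lemma holdsE (R : realType) n (theta : 'I_n -> R) (h : hyp n) :
  holds theta h = (h == true_hyp theta h.1).
Proof.
by case: h => i [] /=; rewrite /holds /true_hyp xpair_eqE eqxx /= ?eqb_id //
  leNgt; case: (0 < theta i).
Qed.

(* A listing of the 2n hypotheses by nondecreasing p-value; it is not unique
   when p-values are tied. *)
Definition orders (R : realType) n (p : hyp n -> R) (s : seq (hyp n)) : Prop :=
  perm_eq s (enum (hyp n)) /\ sorted (fun h k => p h <= p k) s.

(* Number of rejections i^*; the maximum over an empty range is 0.  Positions
   and critical values are numbered from 1, sequences from 0. *)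
Definition istar (R : realType) n (c : nat -> R) (p : hyp n -> R)
    (s : seq (hyp n)) : nat :=
  \max_(1 <= i < n.+1 |
        all (fun j => nth 0 (map p s) j.-1 <= c j) (iota 1 i)) i.

Definition stepdown_rejected (R : realType) n (c : nat -> R) (p : hyp n -> R)
    (s : seq (hyp n)) : seq (hyp n) := take (istar c p s) s.

(* The rule ord lists the hypotheses given their p-values only, hence settles
   ties without knowing which hypotheses are true. *)
Definition V1 (R : realType) n (F : 'I_n -> R -> R -> R) (c : nat -> R)
    (ord : (hyp n -> R) -> seq (hyp n)) (theta t : 'I_n -> R) : nat :=
  let p := pval F t in
  #|[set h : hyp n | holds theta h & h \in stepdown_rejected c p (ord p)]%SET|.

Definition FWER (R : realType) d (Omega : measurableType d) n
    (Pr : ('I_n -> R) -> probability Omega R)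
    (T : 'I_n -> {mfun Omega >-> R}) (F : 'I_n -> R -> R -> R)
    (c : nat -> R) (ord : (hyp n -> R) -> seq (hyp n))
    (theta : 'I_n -> R) : \bar R :=
  Pr theta [set w | (1 <= V1 F c ord theta (fun i => T i w))%N].

Definition critval (R : realType) (n : nat) (alpha : R) (i : nat) : R :=
  alpha / (n%:R - i%:R + 1 + alpha).

Definition cond_prob (R : realType) d (Omega : measurableType d)
    (P : probability Omega R) (A B : set Omega) : R :=
  fine (P (A `&` B)) / fine (P B).

(* The event {P_i <= p}, where P_i is the p-value of the i-th true hypothesis
   under theta. *)
Definition true_pval_le (R : realType) d (Omega : measurableType d) n
    (T : 'I_n -> {mfun Omega >-> R}) (F : 'I_n -> R -> R -> R)
    (theta : 'I_n -> R) (i : 'I_n) (p : R) : set Omega :=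
  [set w | pval F (fun j => T j w) (true_hyp theta i) <= p].

Definition statistics_model (R : realType) d (Omega : measurableType d) n
    (Pr : ('I_n -> R) -> probability Omega R)
    (T : 'I_n -> {mfun Omega >-> R}) (F : 'I_n -> R -> R -> R) : Prop :=
  [/\ forall theta i t,
        cdf (T i : {RV (Pr theta) >-> R}) t = (F i (theta i) t)%:E,
      forall i, continuous (F i 0),
      forall i t, F i 0 (- t) = 1 - F i 0 t &
      forall i t x y, x <= y -> F i y t <= F i x t].

Definition assumption_A1 (R : realType) d (Omega : measurableType d) n
    (Pr : ('I_n -> R) -> probability Omega R)
    (T : 'I_n -> {mfun Omega >-> R}) (F : 'I_n -> R -> R -> R) : Prop :=
  forall theta i p, 0 <= p <= 1 ->
    (Pr theta (true_pval_le T F theta i p) <= p%:E)%E /\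
    (theta i = 0 -> Pr theta (true_pval_le T F theta i p) = p%:E).

(* The law of T_i depends on theta_i only, so that any parameter vector theta0
   with theta0_i = 0 represents Pr_{theta_i = 0}.  On both sides P_i is the
   function of T_i determined by the sign of theta_i. *)
Definition assumption_A2 (R : realType) d (Omega : measurableType d) n
    (Pr : ('I_n -> R) -> probability Omega R)
    (T : 'I_n -> {mfun Omega >-> R}) (F : 'I_n -> R -> R -> R) : Prop :=
  forall (theta theta0 : 'I_n -> R) i p p',
    theta0 i = 0 -> 0 <= p -> p <= p' -> p' <= 1 ->
    let E := true_pval_le T F theta i in
    (0 < Pr theta (E p'))%E -> (0 < Pr theta0 (E p'))%E ->
    cond_prob (Pr theta) (E p) (E p') <= cond_prob (Pr theta0) (E p) (E p').

Definition mutually_independent (R : realType) d (Omega : measurableType d) n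
    (P : probability Omega R) (T : 'I_n -> {mfun Omega >-> R}) : Prop :=
  forall (J : {set 'I_n}) (B : 'I_n -> set R),
    (forall i, i \in J -> measurable (B i)) ->
    P (\bigcap_(i in [set` J]) (T i @^-1` B i)) =
    (\prod_(i in J) P (T i @^-1` B i))%E.

(* Main.v *)
(* Run the stepdown procedure on the false hypotheses alone and let K be the
   number of rejections.  If a true hypothesis is rejected by the full procedure,
   then K < n and some true p-value is at most c_(K+1), where
   c_m = alpha / (n - m + 1 + alpha).  Exactly n - K of the false p-values exceed
   c_(K+1); for such an index i, the event {K = k} depends on T_i only through
   {1 - P_i > c_(k+1)}, so by independence and A.2 the joint probability of
   {K = k} and {P_i <= c_(k+1)} is at most
   c_(k+1) / (1 - c_(k+1)) = alpha / (n - k) times that of {K = k} and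
   {P_i < 1 - c_(k+1)}.  Summing over i gives alpha Pr{K = k}, and summing over k
   gives alpha.  The argument is carried out on the finitely many joint values of
   the indicators {P_i <= c_m}, {1 - P_i <= c_m}, on which the rejection event
   depends; in particular that event is measurable whatever the tie-breaking. *)
Require Import Defs.
From HB Require Import structures.
From mathcomp Require Import all_boot all_order all_algebra.
From mathcomp Require Import all_classical all_reals all_analysis measurable_realfun ring lra.
Set Implicit Arguments.
Unset Strict Implicit.
Unset Printing Implicit Defensive.
Import Order.TTheory GRing.Theory Num.Theory.
Import numFieldNormedType.Exports.
Local Open Scope classical_set_scope.
Local Open Scope ring_scope.


(** * Product measures on a finite power, as sums of weights *)

Section ProductWeights.
Variables (R : realFieldType) (n : nat) (S : finType) (mu : 'I_n -> S -> R).
Hypothesis mu_ge0 : forall i s, 0 <= mu i s.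
Implicit Types f : {ffun 'I_n -> S}.

Definition weight f : R := \prod_i mu i (f i).

Lemma weight_ge0 f : 0 <= weight f.
Proof. by apply: prodr_ge0. Qed.

Definition ffun_upd f (i : 'I_n) (s : S) : {ffun 'I_n -> S} :=
  [ffun j => if j == i then s else f j].

(** Fubini for coordinate [i]: as [D] ignores it, its marginal factors out. The value [s0] only
    picks one representative among the functions that agree off [i]. *)
Lemma sum_weight_split (s0 : S) (i : 'I_n) (A : pred S)
    (D : pred {ffun 'I_n -> S}) :
    (forall f s, D (ffun_upd f i s) = D f) ->
  \sum_(f | D f && A (f i)) weight f =
  (\sum_(s | A s) mu i s) *
  \sum_(f | D f && (f i == s0)) \prod_(j | j != i) mu j (f j).
Proof.
move=> Di.
rewrite big_distrlr /= pair_big_dep /=.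
rewrite (reindex_onto (fun q : S * {ffun 'I_n -> S} => ffun_upd q.2 i q.1)
  (fun f => (f i, ffun_upd f i s0))) /=; last first.
  by move=> f _; apply/ffunP => j; rewrite !ffunE; case: eqP => // ->.
apply: eq_big => [[s f]|[s f] _] /=.
  rewrite Di ffunE eqxx xpair_eqE eqxx /= [RHS]andbA [A s && _]andbC.
  congr (_ && _).
  apply/eqP/eqP => [<-|fi]; first by rewrite !ffunE eqxx.
  by apply/ffunP => j; rewrite !ffunE; case: eqP => // ->.
rewrite /weight (bigD1 i) //= ffunE eqxx; congr (_ * _).
by apply: eq_bigr => j ji; rewrite ffunE (negbTE ji).
Qed.

(** The form in which independence is used: both sides share the factor of the other coordinates, so
    a bound between marginals survives intersection with [D]. *)
Lemma le_sum_weight (s0 : S) (i : 'I_n) (c : R) (A B : pred S)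
    (D : pred {ffun 'I_n -> S}) :
    (forall f s, D (ffun_upd f i s) = D f) ->
    \sum_(s | A s) mu i s <= c * \sum_(s | B s) mu i s ->
  \sum_(f | D f && A (f i)) weight f <= c * \sum_(f | D f && B (f i)) weight f.
Proof.
move=> Di le_AB; rewrite !(sum_weight_split s0 _ Di) mulrA ler_wpM2r //.
by apply: sumr_ge0 => f _; apply: prodr_ge0.
Qed.

Hypothesis mu_sum1 : forall i, \sum_s mu i s = 1.

Lemma sum_weight1 : \sum_f weight f = 1.
Proof.
by rewrite -(bigA_distr_bigA (fun i s => mu i s)) big1.
Qed.

End ProductWeights.

(** * Stepdown rejections as counts, and the bound on the product space *)

Section GridStepdown.
Variables (n : nat) (S : finType) (a b : nat -> pred S).
Implicit Types f : {ffun 'I_n -> S}.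

Definition nfalse f j : nat := (\sum_(i < n) b j (f i))%N.

(** Here [a m] and [b m] stand for the true, respectively the false, p-value of an index being at
    most the [m]-th critical value. Counting level by level expresses rejection without ordering the
    p-values. *)
Definition some_true_rejected f : bool :=
  [exists i, [exists m : 'I_n.+1, [&& (0 < m)%N, a m (f i) &
    [forall j : 'I_n.+1, (0 < j <= m)%N ==>
      (j <= \sum_(i < n) (a j (f i) + b j (f i)))%N]]]].

(* The false hypotheses on their own yield exactly k < n rejections. *)
Definition false_stop f (k : nat) : bool :=
  [forall j : 'I_n.+1, (0 < j <= k)%N ==> (j <= nfalse f j)%N] &&
  (nfalse f k.+1 <= k)%N.

Lemma false_stop_uniq f (k l : 'I_n) : false_stop f k -> false_stop f l -> k = l.
Proof.
wlog le_kl : k l / (k <= l)%N => [W|].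
  by case/orP: (leq_total k l) => kl fk fl; [|apply/esym]; apply: W.
case/andP=> _ fk /andP[/forallP fl _]; apply/val_inj/eqP; rewrite eqn_leq le_kl.
rewrite leqNgt; apply/negP => lt_kl.
have /implyP/= := fl (Ordinal (ltn_ord k : (k.+1 < n.+1)%N)).
by rewrite lt_kl => /(_ isT); rewrite leqNgt ltnS fk.
Qed.

Hypothesis amono :
  forall m m' s, (0 < m <= m')%N -> (m' <= n)%N -> a m s -> a m' s.
Hypothesis bmono :
  forall m m' s, (0 < m <= m')%N -> (m' <= n)%N -> b m s -> b m' s.
Hypothesis ab_disj : forall s, a n s -> ~~ b n s.

Lemma ab_disjW m s : (0 < m <= n)%N -> a m s -> ~~ b m s.
Proof.
by move=> mn /(amono mn (leqnn n))/ab_disj; apply: contraNN; apply: bmono.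
Qed.

(** The count is at least [k] already at level [k], and it grows with the level. So exactly [n - k]
    false p-values exceed the critical value of level [k.+1]. *)
Lemma nfalse_stop f (k : 'I_n) : false_stop f k -> nfalse f k.+1 = k.
Proof.
case/andP=> /forallP fk le_k; apply/eqP; rewrite eqn_leq le_k /=.
have [->//|k_gt0] := posnP k.
have /implyP/= := fk (Ordinal (leqW (ltn_ord k) : (k < n.+1)%N)).
rewrite k_gt0 leqnn => /(_ isT)/leq_trans -> //; apply: leq_sum => i _.
have := @bmono k k.+1 (f i); rewrite k_gt0 leqnSn ltn_ord.
by move=> /(_ isT isT); case: (b k _) => // ->.
Qed.

(** Compare the least level [m] that some true p-value meets with the least [k] at which the false
    hypotheses alone get stuck: [m <= k.+1], and monotonicity lifts the true p-value to level
    [k.+1]. *)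
Lemma true_rejected_false_stop f : some_true_rejected f ->
  exists2 k : 'I_n, false_stop f k & exists i, a k.+1 (f i).
Proof.
case/existsP=> i0 /existsP[m0 /and3P[m0_gt0 a0 /forallP N0]].
pose Q m := (0 < m)%N && [exists i, a m (f i)].
have exQ : exists m, Q m by exists m0; rewrite /Q m0_gt0; apply/existsP; exists i0.
case: (ex_minnP exQ) => m /andP[m_gt0 /existsP[i ai]] minm.
have le_mm0 : (m <= m0)%N.
  by apply: minm; rewrite /Q m0_gt0; apply/existsP; exists i0.
have le_mn : (m <= n)%N by rewrite (leq_trans le_mm0) // -ltnS.
(* The first disjunct guarantees that a least [k] exists; it is excluded further down. *)
pose Z k := (n <= k)%N || (nfalse f k.+1 <= k)%N.
have exZ : exists k, Z k by exists n; rewrite /Z leqnn.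
case: (ex_minnP exZ) => k Zk mink.
have lt_prefix j : (0 < j <= k)%N -> (j <= nfalse f j)%N.
  case: j => // j /= lt_jk; rewrite ltnNge; apply/negP => Hj.
  by have := mink j; rewrite /Z Hj orbT leqNgt lt_jk => /(_ isT).
(* Below level [m] no true p-value is counted, so [k.+1 < m] would make the full count at level
   [k.+1] a count of false p-values, too large for [Z k]. *)
have le_mk : (m <= k.+1)%N.
  rewrite leqNgt; apply/negP => lt_km.
  have lt_kn : (k < n)%N by rewrite (leq_trans _ le_mn) // ltnW.
  move: Zk; rewrite /Z leqNgt lt_kn /= leqNgt => /negP; apply.
  have /implyP/= := N0 (Ordinal (lt_kn : (k.+1 < n.+1)%N)).
  rewrite (leq_trans (ltnW lt_km)) // => /(_ isT)/leq_trans; apply.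
  apply: leq_sum => j _; case E: (a k.+1 (f j)) => //.
  have := minm k.+1; rewrite leqNgt lt_km /Q /= => H.
  by suff : false by []; apply: H; apply/existsP; exists j.
(* Otherwise all [n] false p-values meet level [n], while index [i] has its true one there and
   cannot have both. *)
have lt_kn : (k < n)%N.
  rewrite ltnNge; apply/negP => le_nk.
  have n_gt0 : (0 < n)%N by apply: leq_trans m_gt0 _.
  have : (n <= nfalse f n)%N by apply: lt_prefix; rewrite n_gt0.
  apply/negP; rewrite -ltnNge /nfalse (bigD1 i) //=.
  rewrite (negbTE (ab_disj (amono _ _ ai))) ?m_gt0 ?le_mn ?leqnn // add0n.
  apply: (@leq_ltn_trans (\sum_(j < n | j != i) 1)).
    by apply: leq_sum => j _; apply: leq_b1.
  rewrite sum1_card cardC1 card_ord prednK //.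
exists (Ordinal lt_kn); last first.
  by exists i; apply: amono ai => //=; rewrite m_gt0.
apply/andP; split; last by move: Zk; rewrite /Z leqNgt lt_kn.
by apply/forallP => j; apply/implyP => /lt_prefix.
Qed.

Variables (R : realFieldType) (mu : 'I_n -> S -> R) (alpha : R) (s0 : S).
Hypothesis mu_ge0 : forall i s, 0 <= mu i s.
Hypothesis mu_sum1 : forall i, \sum_s mu i s = 1.
Hypothesis alpha_ge0 : 0 <= alpha.
Hypothesis le_ab : forall i m, (m < n)%N ->
  \sum_(s | a m.+1 s) mu i s <=
  alpha / (n - m)%:R * \sum_(s | ~~ b m.+1 s) mu i s.

(** Both events force the false p-value of [i] to miss level [k.+1], hence all lower levels; the
    stopping condition then depends on the other coordinates only. *)
Lemma le_sum_weight_false_stop (k : 'I_n) i :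
  \sum_(f | false_stop f k && a k.+1 (f i)) weight mu f <=
  alpha / (n - k)%:R *
  \sum_(f | false_stop f k && ~~ b k.+1 (f i)) weight mu f.
Proof.
(* [D] is [false_stop] computed with index [i] left out of the counts. *)
pose M f j := (\sum_(l < n | l != i) b j (f l))%N.
pose D f := [forall j : 'I_n.+1, (0 < j <= k)%N ==> (j <= M f j)%N] &&
  (M f k.+1 <= k)%N.
have DE f : ~~ b k.+1 (f i) -> false_stop f k = D f.
  move=> Nb; have ME j : (0 < j <= k.+1)%N -> nfalse f j = M f j.
    move=> jk; rewrite /nfalse (bigD1 i) //=; case bj: (b j _) => //.
    by rewrite (bmono jk _ bj) in Nb.
  rewrite /false_stop /D ME ?leqnn //; congr (_ && _).
  apply: eq_forallb => j; case: (boolP (0 < j <= k)%N) => //= /andP[j0 jk].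
  by rewrite ME // j0 leqW.
have Di f s : D (ffun_upd f i s) = D f.
  have MS j : M (ffun_upd f i s) j = M f j.
    by apply: eq_bigr => l li; rewrite ffunE (negbTE li).
  by rewrite /D MS; congr (_ && _); apply: eq_forallb => j; rewrite MS.
rewrite (eq_bigl (fun f => D f && a k.+1 (f i))); last first.
  move=> f; case: (boolP (a _ _)); rewrite ?andbF // !andbT => ai.
  by rewrite DE // (ab_disjW _ ai) ?ltn_ord.
rewrite [in leRHS](eq_bigl (fun f => D f && ~~ b k.+1 (f i))).
  exact: (le_sum_weight mu_ge0 s0 (B := fun s => ~~ b k.+1 s) Di (le_ab i _)).
by move=> f; case: (boolP (b _ _)); rewrite ?andbF // !andbT => /DE.
Qed.

Lemma sum_weight_true_rejected :
  \sum_(f | some_true_rejected f) weight mu f <= alpha.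
Proof.
have w0 := weight_ge0 mu_ge0.
(* Union bound over the stopping level [k] and the index [i] of a true p-value at level [k.+1]. *)
apply: (@le_trans _ _ (\sum_(k < n) \sum_(i < n)
    \sum_(f | false_stop f k && a k.+1 (f i)) weight mu f)).
  under [leRHS]eq_bigr do
    (under eq_bigr do rewrite big_mkcond /=; rewrite exchange_big /=).
  rewrite exchange_big big_mkcond /=; apply: ler_sum => f _.
  have t0 k i : 0 <= if false_stop f k && a k.+1 (f i) then weight mu f else 0.
    by case: ifP.
  case: ifP => [/true_rejected_false_stop[k fk [i ai]]|_]; last first.
    by apply: sumr_ge0 => k _; apply: sumr_ge0.
  rewrite (bigD1 k) //= (bigD1 i) //= {1}fk ai -addrA lerDl.
  by apply: addr_ge0; apply: sumr_ge0 => // l _; apply: sumr_ge0.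
(* For fixed [k], each stopped [f] is counted once for each of the [n - k] indices whose false
   p-value misses level [k.+1]; this cancels the denominator. *)
apply: (@le_trans _ _ (\sum_(k < n)
    alpha * \sum_(f | false_stop f k) weight mu f)).
  apply: ler_sum => k _.
  apply: le_trans (ler_sum _ (fun i _ => le_sum_weight_false_stop k i)) _.
  rewrite -mulr_sumr (exchange_big_dep (fun f => false_stop f k)) /=; last by move=> i f _ /andP[].
  rewrite mulr_sumr mulr_sumr; apply: ler_sum => f fk.
  rewrite (eq_bigl (fun i => ~~ b k.+1 (f i))); last by move=> i; rewrite fk.
  rewrite sumr_const.
  have <- : (n - nfalse f k.+1)%N = #|[pred i | ~~ b k.+1 (f i)]|.
    have -> : nfalse f k.+1 = #|[pred i | b k.+1 (f i)]|.
      by rewrite -sum1_card big_mkcond; apply: eq_bigr => l _; rewrite inE; case: (b _ _).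
    have := cardC [pred i | b k.+1 (f i)].
    by rewrite card_ord => {1}<-; rewrite addKn.
  rewrite nfalse_stop //.
  rewrite -[weight mu f *+ _]mulr_natl mulrA divfK //.
  by rewrite pnatr_eq0 subn_eq0 -ltnNge.
(* The stopping level is unique, so the events for different [k] are disjoint and their weights sum
   to at most 1. *)
rewrite -mulr_sumr -[leRHS]mulr1 ler_wpM2l // -(sum_weight1 mu_sum1).
under eq_bigr do rewrite big_mkcond /=.
rewrite exchange_big /=; apply: ler_sum => f _.
case: (pickP (fun k : 'I_n => false_stop f k)) => [k fk|Nf].
  rewrite (bigD1 k) //= fk big1 ?addr0 // => l lk; case: ifP => // fl.
  by rewrite (false_stop_uniq fk fl) eqxx in lk.
by rewrite big1 // => k _; rewrite Nf.
Qed.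

End GridStepdown.

(** * The stepdown procedure on an ordered list of p-values *)

Section Rejection.
Variables (R : realType) (n : nat) (c : nat -> R) (p : hyp n -> R).
Variable s : seq (hyp n).
Hypothesis ps : orders p s.

(** Trades order statistics for counts, which do not see how ties are listed. *)
Lemma orders_nth_le x j : (0 < j <= size s)%N ->
  (nth 0 (map p s) j.-1 <= x) = (j <= #|[set k | (p k <= x)%R]%SET|)%N.
Proof.
case: ps => s_enum s_sorted /andP[j_gt0 j_size].
have sorted_ps : sorted <=%O (map p s) by rewrite sorted_map.
have -> : #|[set k | (p k <= x)%R]%SET| = count (<= x) (map p s).
  rewrite count_map cardsE cardE /enum_mem size_filter.
  by rewrite -enumT -(permP s_enum); apply: eq_count => k /=.
rewrite -{2}(prednK j_gt0); apply/idP/idP => [|/nth_count_le]; last exact.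
apply: contraTT; rewrite -leqNgt -ltNge => le_x.
by apply: nth_count_gt => //; rewrite le_x size_map prednK.
Qed.

Lemma size_orders : size s = n.*2.
Proof.
by case: ps => /perm_size-> _; rewrite -cardE card_prod card_ord card_bool muln2.
Qed.

Lemma lt_istar r :
  (r < istar c p s)%N <->
  (r < n)%N /\
  forall j, (0 < j <= r.+1)%N -> (j <= #|[set k | (p k <= c j)%R]%SET|)%N.
Proof.
have sz_n i : (i <= n)%N -> (i <= size s)%N.
  by move=> /leq_trans; apply; rewrite size_orders -addnn leq_addr.
have allE i : (i <= n)%N ->
    all (fun j => nth 0 (map p s) j.-1 <= c j) (iota 1 i) <->
    forall j, (0 < j <= i)%N -> (j <= #|[set k | (p k <= c j)%R]%SET|)%N.
  move=> le_in; split => [/allP H j|H].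
    case/andP=> j0 ji; rewrite -orders_nth_le; last first.
      by rewrite j0 sz_n // (leq_trans ji).
    by apply: H; rewrite mem_iota j0 add1n ltnS.
  apply/allP => j; rewrite mem_iota add1n ltnS => /andP[j0 ji].
  by rewrite orders_nth_le ?H ?j0 // sz_n // (leq_trans ji).
split=> [|[lt_rn H]]; last first.
  rewrite /istar; apply: (@leq_trans r.+1) => //.
  apply: (@leq_bigmax_seq _ _ _ id) => //; first by rewrite mem_index_iota ltnS.
  exact/allE.
rewrite ltnNge => /negP H.
have [i [/andP[i0 le_in] Ci lt_ri]] : exists i,
  [/\ (0 < i <= n)%N, all (fun j => nth 0 (map p s) j.-1 <= c j) (iota 1 i)
    & (r < i)%N].
  apply: contrapT => N; apply: H; apply/bigmax_leqP_seq => i.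
  rewrite mem_index_iota ltnS => i_n Ci; rewrite leqNgt; apply/negP => lt_ri.
  by apply: N; exists i.
split; first exact: leq_trans lt_ri le_in.
move=> j /andP[j0 jr]; apply: ((allE _ le_in).1 Ci).
by rewrite j0 (leq_trans jr).
Qed.

Hypothesis c_mono :
  forall i j, (0 < i <= j)%N -> (j <= n)%N -> c i <= c j.
Hypothesis card_le_cn : (#|[set k | (p k <= c n)%R]%SET| <= n)%N.

(* No tie straddles the cap of n rejections, because at most n p-values are
   below c n; hence the right-hand side does not mention s. *)
Lemma mem_stepdown_rejected h :
  h \in stepdown_rejected c p s <->
  exists i, [/\ (0 < i <= n)%N, p h <= c i &
    forall j, (0 < j <= i)%N -> (j <= #|[set k | (p k <= c j)%R]%SET|)%N].
Proof.
have hs : h \in s by case: ps => /perm_mem->; rewrite mem_enum.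
have rs : (index h s < size s)%N by rewrite index_mem.
have ph : nth 0 (map p s) (index h s).+1.-1 = p h.
  by rewrite (nth_map h) // nth_index.
rewrite /stepdown_rejected (in_take _ hs) lt_istar; split=> [[lt_n H]|].
  exists (index h s).+1; split => //.
  by rewrite -{1}ph orders_nth_le // H // leqnn.
case=> i [/andP[i0 le_in] phi H].
have rank_le x : p h <= x -> (index h s < #|[set k | (p k <= x)%R]%SET|)%N.
  by move=> phx; rewrite -orders_nth_le // ph.
split.
  apply: leq_trans card_le_cn; apply: rank_le; apply: le_trans phi _.
  by apply: c_mono; rewrite ?i0.
(* For [j] above [i], the hypotheses listed up to [h] have p-values at most [c i], hence at most
   [c j], and there are at least [j] of them. A rank [j > n] would contradict the bound on the count
   at [c n]. *)
move=> j /andP[j0 jr]; have [ji|ij] := leqP j i; first by rewrite H ?j0.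
have [jn|nj] := leqP j n.
  apply: leq_trans jr _; apply: rank_le; apply: le_trans phi _.
  by apply: c_mono; rewrite ?i0 // ltnW.
suff : (j <= n)%N by rewrite leqNgt nj.
apply: leq_trans jr _; apply: leq_trans card_le_cn; apply: rank_le.
by apply: le_trans phi _; apply: c_mono; rewrite ?i0.
Qed.

End Rejection.

(** * Probabilities of events about a finite-valued map *)

Section FiniteValued.
Variables (R : realType) (d : measure_display) (Omega : measurableType d).
Variable P : probability Omega R.

Lemma prob_fin_num (A : set Omega) : measurable A -> P A \is a fin_num.
Proof. exact: fin_num_measure. Qed.

Lemma probability_sum_fibers (S : finType) (X : Omega -> S) (G : pred S) :
    (forall s, measurable (X @^-1` [set s])) ->
  P [set w | G (X w)] = (\sum_(s | G s) fine (P (X @^-1` [set s])))%:E.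
Proof.
move=> mX.
have -> : [set w | G (X w)] = \bigcup_(s in [set` enum G]) (X @^-1` [set s]).
  apply/seteqP; split=> w /= => [Gw|[s Gs Xw]].
    by exists (X w) => //=; rewrite mem_enum.
  by move: Gs => /=; rewrite mem_enum Xw.
rewrite measure_fin_bigcup //; last first.
  by apply/trivIsetP => s t _ _ st; apply/seteqP; split=> // w [/= -> /eqP];
    rewrite (negbTE st).
rewrite -fsbig_seq ?enum_uniq // big_enum /= EFin_sum_fine //.
by move=> s _; apply: prob_fin_num.
Qed.

End FiniteValued.

(** * Marginal laws of the p-values under A.1 and A.2 *)

Section Marginal.
Variables (R : realType) (d : measure_display) (Omega : measurableType d).
Variables (n : nat) (Pr : ('I_n -> R) -> probability Omega R).
Variables (T : 'I_n -> {mfun Omega >-> R}) (F : 'I_n -> R -> R -> R).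
Hypothesis F_cont : forall i, continuous (F i 0).
Hypothesis A1 : assumption_A1 Pr T F.
Hypothesis A2 : assumption_A2 Pr T F.

(** A p-value reads only the statistic of its own index, so a constant vector presents it as a
    function of one real. *)
Lemma measurable_pval_cst h : measurable_fun setT (fun u => pval F (fun=> u) h).
Proof.
have mF : measurable_fun setT (F h.1 0) by apply: continuous_measurable_fun.
by case: h mF => i [] //= mF; rewrite /pval /=; apply: measurable_funB.
Qed.

Lemma measurable_pval h : measurable_fun setT (fun w => pval F (T^~ w) h).
Proof. exact: (measurableT_comp (measurable_pval_cst h)). Qed.

Lemma measurable_pval_itv h (I : interval R) :
  measurable [set w | pval F (T^~ w) h \in I].
Proof.
by have := measurable_pval h measurableT (measurable_itv I); rewrite setTI.
Qed.

Lemma measurable_pval_le h x : measurable [set w | pval F (T^~ w) h <= x].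
Proof. exact: (measurable_pval_itv h `]-oo, x]). Qed.

Lemma measurable_pval_lt h x : measurable [set w | pval F (T^~ w) h < x].
Proof. exact: (measurable_pval_itv h `]-oo, x[). Qed.

Lemma set_pval_gt h x : [set w | x < pval F (T^~ w) h] =
  ~` [set w | pval F (T^~ w) h <= x].
Proof.
by apply/seteqP; split=> w /=; rewrite real_ltNge ?num_real // => /negP.
Qed.

Lemma measurable_pval_gt h x : measurable [set w | x < pval F (T^~ w) h].
Proof. by rewrite set_pval_gt; apply: measurableC; apply: measurable_pval_le. Qed.

Lemma pval_negb (t : 'I_n -> R) i b : pval F t (i, ~~ b) = 1 - pval F t (i, b).
Proof. by case: b; rewrite /pval //= subKr. Qed.

Section NullParameter.
Variables (theta0 : 'I_n -> R) (i : 'I_n).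
Hypothesis theta0i : theta0 i = 0.
Let p0 b := fun w => pval F (T^~ w) (i, b).

Lemma null_pval_le p : 0 <= p <= 1 ->
  Pr theta0 [set w | p0 false w <= p] = p%:E.
Proof.
by move=> /(A1 theta0 i)[_ /(_ theta0i)]; rewrite /true_pval_le /true_hyp theta0i ltxx.
Qed.

Lemma null_pval_gt p : 0 <= p <= 1 ->
  Pr theta0 [set w | p < p0 false w] = (1 - p)%:E.
Proof.
move=> p01; rewrite set_pval_gt.
by rewrite probability_setC ?null_pval_le //; apply: measurable_pval_le.
Qed.

(** At parameter 0 the true hypothesis is the one with flag [false], so A.1 gives uniformity for
    that flag only. The other p-value is its complement to 1, handled here and in the converse
    bound. *)
Lemma ge_null_pval b p : 0 <= p <= 1 ->
  (p%:E <= Pr theta0 [set w | (p0 b w <= p)%R])%E.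
Proof.
move=> p01; case: b; last by rewrite null_pval_le.
have p01' : 0 <= 1 - p <= 1.
  by case/andP: p01 => ? ?; rewrite subr_ge0 gerBl; apply/andP.
rewrite -[p in leLHS](subKr 1) -null_pval_gt //.
apply: le_measure; rewrite ?inE; [exact: measurable_pval_gt|exact: measurable_pval_le|].
move=> w /=; rewrite /p0 -[true]/(~~ false) pval_negb => /ltW.
by rewrite !lerBlDr addrC.
Qed.

Lemma null_pval_le_le b p : 0 <= p <= 1 ->
  (Pr theta0 [set w | (p0 b w <= p)%R] <= p%:E)%E.
Proof.
move=> /andP[p0' p1]; case: b; last by rewrite null_pval_le ?p0'.
(* Complementation turns [<= p] into a non-strict lower bound on the other p-value; the slack [e]
   makes it strict, as [null_pval_gt] requires. *)
apply/lee_addgt0Pr => e e0.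
have [le1|lt1] := leP 1 (p + e).
  apply: le_trans (probability_le1 _ (measurable_pval_le _ _)) _.
  by rewrite -EFinD lee_fin.
have q01 : 0 <= 1 - (p + e) <= 1.
  by rewrite subr_ge0 ltW //= gerBl addr_ge0 // ltW.
rewrite -EFinD -(subKr 1 (p + e)) -null_pval_gt //.
apply: le_measure; rewrite ?inE; [exact: measurable_pval_le|exact: measurable_pval_gt|].
move=> w /=; rewrite /p0 -[true]/(~~ false) pval_negb => le_p.
by rewrite ltrBlDr -ltrBlDl (le_lt_trans le_p) // ltrDl.
Qed.

End NullParameter.

(** A.2 compared with the zero parameter vector, where the conditional probability is at most
    [p / p']. The cross-multiplied form also covers conditioning events of probability zero. *)
Lemma true_pval_ratio theta i p p' : 0 <= p -> p <= p' -> p' <= 1 ->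
  p' * fine (Pr theta (true_pval_le T F theta i p)) <=
  p * fine (Pr theta (true_pval_le T F theta i p')).
Proof.
move=> p0 pp' p'1; set E := true_pval_le T F theta i.
have mE q : measurable (E q) by apply: measurable_pval_le.
have sub : E p `<=` E p' by move=> w /= /le_trans; apply.
have leE : fine (Pr theta (E p)) <= fine (Pr theta (E p')).
  by rewrite fine_le ?prob_fin_num // le_measure ?inE.
have ge0 q : 0 <= fine (Pr theta (E q)) by rewrite fine_ge0.
have p'0 := le_trans p0 pp'.
have [Ep'0|Ep'0] := eqVneq (fine (Pr theta (E p'))) 0.
  have -> : fine (Pr theta (E p)) = 0 by apply/le_anti; rewrite ge0 -Ep'0 leE.
  by rewrite Ep'0 !mulr0.
have [p'z|p'N0] := eqVneq p' 0.
  by rewrite p'z mul0r mulr_ge0.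
have p'_gt0 : 0 < p' by rewrite lt_def p'N0.
have p'01 : 0 <= p' <= 1 by rewrite p'0.
have p01 : 0 <= p <= 1 by rewrite p0 (le_trans pp').
pose theta0 : 'I_n -> R := fun=> 0.
have Ep'_gt0 : 0 < fine (Pr theta (E p')) by rewrite lt_def Ep'0 ge0.
have le0 : fine (Pr theta0 (E p)) <= p.
  by rewrite -lee_fin fineK ?prob_fin_num //; apply: null_pval_le_le.
have ge0' : p' <= fine (Pr theta0 (E p')).
  by rewrite -lee_fin fineK ?prob_fin_num //; apply: ge_null_pval.
have Ep'_pos : (0 < Pr theta (E p'))%E.
  by rewrite -(fineK (prob_fin_num _ (mE _))) lte_fin.
have Ep'0_pos : (0 < Pr theta0 (E p'))%E.
  rewrite -(fineK (prob_fin_num _ (mE _))) lte_fin.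
  exact: lt_le_trans p'_gt0 ge0'.
have := A2 (theta := theta) (theta0 := theta0) (i := i) erefl p0 pp' p'1
  Ep'_pos Ep'0_pos.
rewrite /cond_prob -/E setIidl // ler_pdivrMr // => le1.
have b_gt0 := lt_le_trans p'_gt0 ge0'.
apply: le_trans (ler_wpM2l p'0 le1) _; rewrite mulrA ler_wpM2r ?ge0 //.
rewrite mulrCA -[leRHS]mulr1 ler_pM //; first by rewrite fine_ge0.
  by rewrite divr_ge0 // ltW.
by rewrite ler_pdivrMr // mul1r.
Qed.

(** The strict event is approached from inside by closed ones with bound [p' < q]. Strictness is
    needed because [1 - P_i > c] means [P_i < 1 - c]. *)
Lemma true_pval_ratio_lt theta i p q : 0 <= p -> p < q -> q <= 1 ->
  q * fine (Pr theta (true_pval_le T F theta i p)) <=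
  p * fine (Pr theta [set w | pval F (T^~ w) (true_hyp theta i) < q]).
Proof.
move=> p0 pq q1; set E := true_pval_le T F theta i.
have mE r : measurable (E r) by apply: measurable_pval_le.
have mL : measurable [set w | pval F (T^~ w) (true_hyp theta i) < q].
  exact: measurable_pval_lt.
apply/ler_addgt0Pr => e e0.
(* The maximum keeps [p <= p'], as A.2 demands, while [p'] stays within [e] of [q]. *)
pose p' := Num.max p (q - e).
have p'q : p' < q by rewrite gt_max pq gtrBl.
have pp' : p <= p' by rewrite le_max lexx.
have qp' : q <= p' + e by rewrite -lerBlDr le_max lexx orbT.
have ge0 : 0 <= fine (Pr theta (E p)) by rewrite fine_ge0.
apply: le_trans (ler_wpM2r ge0 qp') _; rewrite mulrDl; apply: lerD.
  apply: le_trans (true_pval_ratio _ _ p0 pp' (le_trans (ltW p'q) q1)) _.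
  rewrite ler_wpM2l // fine_le ?prob_fin_num // le_measure ?inE //.
  by move=> w /= /le_lt_trans; apply.
rewrite -[leRHS]mulr1 ler_wpM2l ?(ltW e0) // -lee_fin fineK ?prob_fin_num //.
exact: probability_le1.
Qed.

End Marginal.

(** * Discretization of the statistics by the critical values *)

Section Grid.
Variables (R : realType) (n : nat) (F : 'I_n -> R -> R -> R).
Variables (theta : 'I_n -> R) (c : nat -> R).
Implicit Type t : 'I_n -> R.

(** The exclusive or with the sign of the parameter makes flag [false] denote the true hypothesis of
    index [i] and flag [true] the false one. *)
Definition grid_fun (i : 'I_n) (u : R) : {ffun bool * 'I_n.+1 -> bool} :=
  [ffun x : bool * 'I_n.+1 =>
     pval F (fun=> u) (i, (0 < theta i) (+) x.1) <= c x.2].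

(* Restricting to attained values makes the events below monotone in m and
   mutually exclusive at m = n. *)
Definition grid : finType :=
  {s : {ffun bool * 'I_n.+1 -> bool} | `[< exists i u, s = grid_fun i u >]}.

Definition grid_cell (i : 'I_n) (u : R) : grid :=
  exist _ (grid_fun i u)
    (asboolT (ex_intro _ i (ex_intro _ u (erefl (grid_fun i u))))).

Definition true_le m : pred grid := fun s => val s (false, inord m).
Definition false_le m : pred grid := fun s => val s (true, inord m).

Lemma gridP (s : grid) : exists i u, s = grid_cell i u.
Proof.
have /asboolP[i [u su]] := valP s.
by exists i, u; apply: val_inj.
Qed.

Lemma true_leE t i m : (m <= n)%N ->
  true_le m (grid_cell i (t i)) = (pval F t (true_hyp theta i) <= c m).
Proof. by move=> mn; rewrite /true_le ffunE /= addbF inordK. Qed.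

Lemma false_leE t i m : (m <= n)%N ->
  false_le m (grid_cell i (t i)) = (pval F t (i, ~~ (0 < theta i)) <= c m).
Proof. by move=> mn; rewrite /false_le ffunE /= addbT inordK. Qed.

Lemma card_pval_le t m : (m <= n)%N ->
  #|[set k | (pval F t k <= c m)%R]%SET| =
  (\sum_(i < n) (true_le m (grid_cell i (t i)) +
                 false_le m (grid_cell i (t i))))%N.
Proof.
move=> mn; rewrite cardsE -sum1_card big_mkcond /=.
rewrite -(pair_bigA _ (fun i b =>
  if (pval F t (i, b) <= c m)%R then 1%N else 0%N)) /=.
apply: eq_bigr => i _; rewrite big_bool true_leE // false_leE // /true_hyp.
by case: (0 < theta i) => /=; do 2!case: (_ <= c m).
Qed.

Hypothesis c_mono :
  forall i j, (0 < i <= j)%N -> (j <= n)%N -> c i <= c j.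
Hypothesis cn_lt : c n < 2^-1.

Lemma pval_le_cn t i b : pval F t (i, b) <= c n -> ~~ (pval F t (i, ~~ b) <= c n).
Proof.
by rewrite pval_negb -ltNge; move: cn_lt; lra.
Qed.

Lemma true_le_mono m m' s : (0 < m <= m')%N -> (m' <= n)%N ->
  true_le m s -> true_le m' s.
Proof.
have [i [u ->]] := gridP s => mm' m'n; have /andP[_ le_mm'] := mm'.
rewrite !(true_leE (fun=> u)) ?(leq_trans le_mm') // => /le_trans; apply.
exact: c_mono.
Qed.

Lemma false_le_mono m m' s : (0 < m <= m')%N -> (m' <= n)%N ->
  false_le m s -> false_le m' s.
Proof.
have [i [u ->]] := gridP s => mm' m'n; have /andP[_ le_mm'] := mm'.
rewrite !(false_leE (fun=> u)) ?(leq_trans le_mm') // => /le_trans; apply.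
exact: c_mono.
Qed.

Lemma true_false_le_disj s : true_le n s -> ~~ false_le n s.
Proof.
have [i [u ->]] := gridP s.
by rewrite (true_leE (fun=> u)) // (false_leE (fun=> u)) // => /pval_le_cn.
Qed.

(** The two p-values of an index sum to 1 and [c n < 1/2], so at most one of them counts: projection
    to the index is injective on this set. *)
Lemma card_pval_le_cn t : (#|[set k | (pval F t k <= c n)%R]%SET| <= n)%N.
Proof.
rewrite -[leqRHS]card_ord -(card_in_imset (f := fst)) ?max_card //.
move=> [i b] [j b']; rewrite !inE /= => pb pb' ij; rewrite -{j}ij in pb' *.
by case: b b' pb pb' => [] [] // /pval_le_cn/negP.
Qed.

(** Brings the error event, for any tie-breaking rule, down to a predicate on the grid cells, to
    which the finite bound applies. *)
Lemma V1_gt0 (ord : (hyp n -> R) -> seq (hyp n)) t :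
    (forall p, orders p (ord p)) ->
  (1 <= V1 F c ord theta t)%N =
  some_true_rejected true_le false_le [ffun i => grid_cell i (t i)].
Proof.
move=> hord; pose p := pval F t.
have rejE h := mem_stepdown_rejected (hord p) c_mono (card_pval_le_cn t) h.
rewrite /V1 /= card_gt0; apply/set0Pn/existsP => /=.
  case=> [[i b]]; rewrite inE holdsE => /andP[/eqP-> /rejE].
  case=> m [/andP[m0 mn] pm H]; exists i; apply/existsP.
  have mn' : (m < n.+1)%N by [].
  exists (Ordinal mn'); rewrite /= m0 ffunE true_leE // pm /=.
  apply/forallP => j; apply/implyP => /H; rewrite card_pval_le; last first.
    by rewrite -ltnS.
  by under [in X in _ -> X]eq_bigr do rewrite ffunE.
case=> i /existsP[m /and3P[m0 am /forallP H]]; exists (true_hyp theta i).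
rewrite inE holdsE eqxx /=; apply/rejE; exists m.
have mn : (m <= n)%N by rewrite -ltnS.
rewrite m0 mn; split => //; first by rewrite ffunE true_leE in am.
move=> j /[dup] /andP[j0 jm] jm'.
have jn : (j < n.+1)%N by rewrite ltnS (leq_trans jm).
have /implyP/= := H (Ordinal jn).
rewrite jm' card_pval_le // => /(_ isT).
by under eq_bigr do rewrite ffunE.
Qed.

Lemma measurable_grid_cell i s :
    (forall i, continuous (F i 0)) ->
  measurable (grid_cell i @^-1` [set s]).
Proof.
move=> F_cont.
have -> : grid_cell i @^-1` [set s] = \bigcap_(x in [set: bool * 'I_n.+1])
    [set u | (pval F (fun=> u) (i, (0 < theta i) (+) x.1) <= c x.2) = val s x].
  apply/seteqP; split=> u /= => [<- x _|H]; first by rewrite /= ffunE.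
  by apply/val_inj/ffunP => x; rewrite ffunE; apply: H.
apply: fin_bigcap_measurable; first exact: finite_finset.
move=> x _; set h := (i, _).
have mle : measurable [set u | pval F (fun=> u) h <= c x.2].
  have := measurable_pval_cst F_cont h measurableT
    (measurable_itv `]-oo, c x.2]).
  by rewrite setTI.
case: (val s x) => //; rewrite -[X in measurable X]setCK; apply: measurableC.
by congr measurable: mle; apply/seteqP; split=> u /=; case: (_ <= _).
Qed.

End Grid.

(** * The critical values, and control of the error rate *)

Lemma critvalE (R : realType) n (alpha : R) m : (m < n)%N ->
  critval n alpha m.+1 = alpha / ((n - m)%:R + alpha).
Proof.
by move=> mn; rewrite /critval natrB ?(ltnW mn) // -natr1 opprD addrA addrNK.
Qed.

Lemma critval_le (R : realType) n (alpha : R) i j : 0 < alpha ->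
  (0 < i <= j)%N -> (j <= n)%N -> critval n alpha i <= critval n alpha j.
Proof.
case: i => // i; case: j => // j a0; rewrite /= ltnS => ij jn.
rewrite !critvalE ?(leq_ltn_trans ij) // ler_pM2l // lef_pV2 ?posrE.
- by rewrite lerD2r ler_nat leq_sub2l.
- by rewrite ltr_wpDl.
- by rewrite ltr_wpDl.
Qed.

Theorem theorem2 (R : realType) (n : nat) (hn : (1 <= n)%N)
    (alpha : R) (halpha : 0 < alpha < 1)
    (d : measure_display) (Omega : measurableType d)
    (Pr : ('I_n -> R) -> probability Omega R)
    (T : 'I_n -> {mfun Omega >-> R}) (F : 'I_n -> R -> R -> R)
    (hmodel : statistics_model Pr T F)
    (hA1 : assumption_A1 Pr T F)
    (hA2 : assumption_A2 Pr T F)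
    (hA3 : forall theta : 'I_n -> R, mutually_independent (Pr theta) T)
    (ord : (hyp n -> R) -> seq (hyp n))
    (hord : forall p : hyp n -> R, orders p (ord p)) :
  forall theta : 'I_n -> R,
    (FWER Pr T F (critval n alpha) ord theta <= alpha%:E)%E.
Proof.
move=> theta; case/andP: halpha => a0 a1; case: hmodel => _ F_cont _ _.
set c := critval n alpha; set P := Pr theta.
have c_mono i j : (0 < i <= j)%N -> (j <= n)%N -> c i <= c j.
  exact: critval_le.
(* The last critical value is [alpha / (1 + alpha)], below one half because [alpha < 1]. *)
have cn_lt : c n < 2^-1.
  rewrite /c /critval subrr add0r.
  by rewrite ltr_pdivrMr ?ltr_wpDl //; lra.
pose X i w := grid_cell F theta c i (T i w).
pose Xf w := [ffun i => X i w].
have mX i s : measurable (X i @^-1` [set s]).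
  have := measurable_funPT (T i) measurableT _
    (measurable_grid_cell i s F_cont).
  by rewrite setTI.
pose mu i s := fine (P (X i @^-1` [set s])).
have XfE f : Xf @^-1` [set f] = \bigcap_(i in [set` [set: 'I_n]%SET])
    (T i @^-1` (grid_cell F theta c i @^-1` [set f i])).
  apply/seteqP; split=> w /= => [<- i _|H]; first by rewrite ffunE.
  by apply/ffunP => i; rewrite ffunE; apply: H; rewrite /= inE.
have mXf f : measurable (Xf @^-1` [set f]).
  by rewrite XfE; apply: fin_bigcap_measurable => // i _; apply: mX.
(* Independence over the full index set gives the joint cell law as the product of the marginal
   ones. *)
have PXf f : fine (P (Xf @^-1` [set f])) = weight mu f.
  rewrite XfE hA3 => [|i _]; last exact: measurable_grid_cell.
  rewrite (eq_bigr (fun i => (mu i (f i))%:E)); last first.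
    by move=> i _; rewrite fineK // prob_fin_num.
  by rewrite prodEFin /= /weight; apply: eq_bigl => i; rewrite inE.
rewrite /FWER.
under eq_set do rewrite (V1_gt0 F theta c_mono cn_lt) //.
rewrite (probability_sum_fibers _ (X := Xf)) // lee_fin.
rewrite (eq_bigr (weight mu)) //.
(* The grid is inhabited: index 0 exists since [n >= 1], and [point] is the default outcome of
   [Omega]. *)
pose s0 : grid F theta c := X (Ordinal hn) point.
have sum_mu i (G : pred (grid F theta c)) :
    \sum_(s | G s) mu i s = fine (P [set w | G (X i w)]).
  by rewrite (probability_sum_fibers _ (X := X i)).
apply: (sum_weight_true_rejected _ _ _ s0) => //.
- by move=> m m' s; apply: true_le_mono.
- by move=> m m' s; apply: false_le_mono.
- by move=> s; apply: true_false_le_disj.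
- by move=> i s; rewrite /mu fine_ge0.
- move=> i; rewrite sum_mu (_ : [set _ | _] = setT) ?probability_setT //.
  by apply/seteqP; split.
- exact: ltW.
(* What remains is the marginal bound, with ratio [c / (1 - c) = alpha / (n - m)] for [c] the
   critical value of level [m.+1]. *)
move=> i m mn; rewrite !sum_mu.
have den_gt0 : 0 < (n - m)%:R + alpha by rewrite ltr_wpDl.
have num_gt0 : 0 < (n - m)%:R :> R by rewrite ltr0n subn_gt0.
have cE : c m.+1 = alpha / ((n - m)%:R + alpha) by rewrite /c critvalE.
have -> : [set w | true_le m.+1 (X i w)] = true_pval_le T F theta i (c m.+1).
  by apply/seteqP; split=> w /=; rewrite (true_leE _ _ _ (T^~ w)).
have -> : [set w | ~~ false_le m.+1 (X i w)] =
    [set w | pval F (T^~ w) (true_hyp theta i) < 1 - c m.+1].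
  apply/seteqP; split=> w /=; rewrite (false_leE _ _ _ (T^~ w)) // pval_negb;
    by rewrite -ltNge ltrBrDr -ltrBrDl addrC.
have c0 : 0 <= c m.+1 by rewrite cE divr_ge0 // ltW.
have cm_lt : c m.+1 < 2^-1 by rewrite (le_lt_trans _ cn_lt) // c_mono.
have := true_pval_ratio_lt F_cont hA1 hA2 theta i c0 (q := 1 - c m.+1).
rewrite gerBl => /(_ ltac:(lra) c0).
have -> : 1 - c m.+1 = (n - m)%:R / ((n - m)%:R + alpha).
  by rewrite cE; field; rewrite gt_eqF.
rewrite {2}cE -/P => H.
(* Both sides are multiplied by [1 - c m.+1], the factor on the left of [H]. *)
rewrite -(ler_pM2l (divr_gt0 num_gt0 den_gt0)) (le_trans H) //.
rewrite mulrA le_eqVlt; apply/orP; left; apply/eqP; congr (_ * _).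
by field; rewrite !gt_eqF.
Qed.
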